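(* Let $\alpha>0$, $x_0,\omega\in\mathbb{R}$, and let $f(x)=\mathrm{e}^{-\alpha(x-x_0)^2}\cos(\omega x)$. Let $\lambda>0$ satisfy $\lambda\ge |x_0|$, and for $n\in\mathbb{Z}$ let $$a_{n,\lambda}(\omega)=\frac{1}{(2\lambda)^{1/2}}\int_{-\lambda}^{\lambda}\mathrm{e}^{-\alpha(x-x_0)^2}\cos(\omega x)\exp\left(-\frac{\pi \mathrm{i} n x}{\lambda}\right)\mathrm{d}x$$ be the $n$-th coefficient of $f$ in the stretched Fourier basis with stretching parameter $\lambda$. Then for all $n\in\mathbb{Z}$, $$|a_{n,\lambda}(\omega)|\le\left(\frac{\pi}{2\alpha\lambda}\right)^{1/2}\left[\exp\left(-\frac{(\pi|n|-\lambda\omega)^2}{4\alpha\lambda^2}\right)+\exp\left(-\alpha(\lambda-|x_0|)^2\right)\right].$$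
   Context: The stretched Fourier basis with stretching parameter $\lambda>0$ consists of the functions $\varphi_n(x)=(2\lambda)^{-1/2}\mathrm{e}^{\mathrm{i}\pi n x/\lambda}$ for $x\in[-\lambda,\lambda]$ and $\varphi_n(x)=0$ for $x\in\mathbb{R}\setminus[-\lambda,\lambda]$, $n\in\mathbb{Z}$. The coefficient of $f$ is $\int_{\mathbb{R}}f(x)\overline{\varphi_n(x)}\,\mathrm{d}x$.
   Formalization: The bound is proved with $(\pi|n|-\lambda|\omega|)^2$ in place of $(\pi|n|-\lambda\omega)^2$; the printed form fails for $\omega<0$ (e.g. $\alpha=1$, $x_0=0$, $\lambda=n=10$, $\omega=-\pi$), and the two agree for $\omega\ge0$. *)

(* Defs.v *)
From Stdlib Require Import Reals Lra.
From Coquelicot Require Import Coquelicot.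

Local Open Scope C_scope.

Definition Cexp (z : C) : C :=
  RtoC (exp (Re z)) * (RtoC (cos (Im z)) + Ci * RtoC (sin (Im z))).

Definition stretched_fourier (lam : R) (n : Z) (x : R) : C :=
  if Rle_dec (Rabs x) lam
  then RtoC (/ sqrt (2 * lam)) * Cexp (Ci * PI * IZR n * x / lam)
  else 0.

(* [RInt] is total; the integrand has to be Riemann integrable on [-lam, lam]
   for this to be meaningful.  See [is_RInt_gen_stretched_coef] for the agreement
   with the integral of f * conj(phi_n) over the whole line. *)
Definition stretched_coef (lam : R) (f : R -> C) (n : Z) : C :=
  RtoC (/ sqrt (2 * lam)) *
  RInt (V := C_R_CompleteNormedModule)
    (fun x : R => f x * Cexp (- (PI * Ci * IZR n * x / lam))) (- lam) lam.

Definition gauss_cos (alpha x0 omega x : R) : R :=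
  (exp (- alpha * (x - x0) ^ 2) * cos (omega * x))%R.

Lemma Cconj_Cexp (z : C) : Cconj (Cexp z) = Cexp (Cconj z).
Proof.
destruct z as [a b]; unfold Cexp; cbn.
rewrite cos_neg, sin_neg; unfold Cconj, Cmult, Cplus, RtoC, Ci; cbn.
f_equal; ring.
Qed.

Lemma Cconj_stretched_fourier (lam : R) (n : Z) (x : R) :
  (0 < lam)%R -> (Rabs x <= lam)%R ->
  Cconj (stretched_fourier lam n x) =
  RtoC (/ sqrt (2 * lam)) * Cexp (- (PI * Ci * IZR n * x / lam)).
Proof.
intros Hlam Hx; unfold stretched_fourier.
destruct (Rle_dec (Rabs x) lam) as [_ | H]; [ | now elim H ].
rewrite Cmult_conj, Cconj_Cexp; f_equal.
- unfold Cconj, RtoC; cbn; f_equal; ring.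
- f_equal; unfold Cdiv, Cinv, Cconj, Cmult, Copp, RtoC, Ci; cbn.
  f_equal; field; lra.
Qed.

Lemma is_RInt_gen_stretched_coef (lam : R) (f : R -> C) (n : Z) :
  (0 < lam)%R ->
  ex_RInt (V := C_R_NormedModule)
    (fun x : R => f x * Cexp (- (PI * Ci * IZR n * x / lam))) (- lam) lam ->
  is_RInt_gen (V := C_R_NormedModule)
    (fun x : R => f x * Cconj (stretched_fourier lam n x))
    (Rbar_locally m_infty) (Rbar_locally p_infty) (stretched_coef lam f n).
Proof.
intros Hlam Hex P HP.
assert (Hz : forall a b : R, (forall x, (Rmin a b < x < Rmax a b)%R ->
     (lam < Rabs x)%R) ->
   is_RInt (V := C_R_NormedModule)
     (fun x : R => f x * Cconj (stretched_fourier lam n x)) a b zero).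
{ intros a b H.
  apply is_RInt_ext with (fun _ : R => zero : C_R_NormedModule).
  - intros x Hx; specialize (H x Hx); unfold stretched_fourier.
    destruct (Rle_dec (Rabs x) lam) as [H' | _]; [ lra | ].
    transitivity (f x * Cconj 0); [ | reflexivity ].
    replace (Cconj 0) with (RtoC 0);
      [ symmetry; apply Cmult_0_r | unfold Cconj, RtoC; cbn; f_equal; ring ].
  - assert (H0 := is_RInt_const (V := C_R_NormedModule) a b zero).
    assert (Hs := scal_zero_r (V := C_R_NormedModule) (b - a)%R).
    exact (eq_ind _ (is_RInt (V := C_R_NormedModule) _ a b) H0 _ Hs). }
assert (Hm : is_RInt (V := C_R_NormedModule)
     (fun x : R => f x * Cconj (stretched_fourier lam n x)) (- lam) lam
     (stretched_coef lam f n)).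
{ unfold stretched_coef.
  apply is_RInt_ext with (fun x : R => scal (/ sqrt (2 * lam))%R
    (f x * Cexp (- (PI * Ci * IZR n * x / lam)) : C_R_NormedModule)).
  - intros x; rewrite Rmin_left, Rmax_right by lra; intros Hx.
    rewrite Cconj_stretched_fourier; [ | lra | apply Rabs_le; lra ].
    rewrite scal_R_Cmult.
    rewrite !Cmult_assoc; f_equal; apply Cmult_comm.
  - rewrite <- (scal_R_Cmult (/ sqrt (2 * lam))%R).
    apply (is_RInt_scal (V := C_R_NormedModule)).
    now apply (RInt_correct (V := C_R_CompleteNormedModule)). }
apply locally_singleton in HP as HP'.
exists (fun a => (a < - lam)%R) (fun b => (lam < b)%R).
- now exists (- lam)%R.
- now exists lam.
- intros a b Ha Hb; exists (stretched_coef lam f n); split; [ | exact HP' ].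
  cbn [fst snd].
  rewrite <- (plus_zero_r (stretched_coef lam f n : C_R_NormedModule)).
  apply is_RInt_Chasles with lam.
  + rewrite <- (plus_zero_l (stretched_coef lam f n : C_R_NormedModule)).
    apply is_RInt_Chasles with (- lam)%R; [ | exact Hm ].
    apply Hz; intros x; rewrite Rmin_left, Rmax_right by lra; intros Hx.
    rewrite Rabs_left; lra.
  + apply Hz; intros x; rewrite Rmin_left, Rmax_right by lra; intros Hx.
    rewrite Rabs_right; lra.
Qed.

(* Main.v *)
Require Import Defs.
From Stdlib Require Import Reals.
From Coquelicot Require Import Coquelicot.
From Stdlib Require Import Lra.

Local Open Scope R_scope.

(* Writing the product of the two cosines as a sum leaves the integrals of
   exp (- al * x ^ 2) * exp (- I k x) over [a, b], with a <= 0 <= b.  With k = 2 al s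
   and F(s) the integral of exp (- al * (x + I s) ^ 2), the derivative of F consists of
   boundary terms of modulus at most exp (al * s ^ 2) * (exp (- al * a ^ 2) + exp (- al * b ^ 2)),
   while F(0) <= sqrt (PI / al).  Multiplying back by exp (- al * s ^ 2), the boundary
   terms are weighted by Dawson's integral exp (- al * s ^ 2) * int_0^s exp (al * u ^ 2),
   which is at most sqrt (PI / al) / 2 since u ^ 2 - s ^ 2 <= - (s - u) ^ 2. A complex modulus is bounded through the real parts
   of its rotations, (c, d) being a unit vector throughout. *)

(** * Differentiation and monotonicity for real integrals *)

Lemma exp_le (x y : R) : x <= y -> exp x <= exp y.
Proof. intros [H | ->]; [ now apply Rlt_le, exp_increasing | apply Rle_refl ]. Qed.

Lemma RInt_ex_derive (f : R -> R) (a b : R) :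
  (forall x, ex_derive f x) -> ex_RInt f a b.
Proof.
intros H; apply (ex_RInt_continuous (V := R_CompleteNormedModule)).
intros x _; apply (ex_derive_continuous (V := R_NormedModule)), H.
Qed.

Lemma nonpos_derive_le (f df : R -> R) (t : R) :
  0 <= t -> (forall x, 0 <= x -> is_derive f x (df x)) ->
  (forall x, 0 <= x -> df x <= 0) -> f t <= f 0.
Proof.
intros Ht Hf Hdf.
destruct (MVT_gen f 0 t df) as [c [Hc E]].
- intros x; rewrite Rmin_left by lra; intros Hx; apply Hf; lra.
- intros x; rewrite Rmin_left by lra; intros Hx.
  apply derivable_continuous_pt; exists (df x).
  apply is_derive_Reals, Hf; lra.
- rewrite Rmin_left, Rmax_right in Hc by lra.
  assert (H := Hdf c (proj1 Hc)); nra.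
Qed.

(** Differentiation under the integral sign, with global hypotheses and a named derivative [df] in
    place of [Derive]. *)
Lemma is_derive_RInt_parameter (f df : R -> R -> R) (a b u : R) :
  (forall u x, is_derive (fun v => f v x) u (df u x)) ->
  (forall u x, continuity_2d_pt df u x) ->
  (forall u x, ex_derive (f u) x) ->
  is_derive (fun v => RInt (f v) a b) u (RInt (df u) a b).
Proof.
intros Hd Hc Hx.
rewrite (RInt_ext (df u) (fun x => Derive (fun v => f v x) u)).
2: intros x _; symmetry; now apply is_derive_unique.
apply (is_derive_RInt_param f).
- apply filter_forall; intros v x _; exists (df v x); apply Hd.
- intros x _; apply continuity_2d_pt_ext with df; [ | apply Hc ].
  intros v y; symmetry; now apply is_derive_unique.
- apply filter_forall; intros v; apply RInt_ex_derive, Hx.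
Qed.

Lemma is_derive_RInt_upper (f : R -> R) (a t : R) :
  (forall x, ex_derive f x) -> is_derive (fun u => RInt f a u) t (f t).
Proof.
intros H; apply (is_derive_RInt f _ a).
- apply filter_forall; intros u.
  apply (RInt_correct (V := R_CompleteNormedModule)), RInt_ex_derive, H.
- apply (ex_derive_continuous (V := R_NormedModule)), H.
Qed.

(** Discharges the joint continuity needed for differentiating under the integral sign; squares are
    the only powers covered. *)
Ltac cont2d :=
  repeat first
  [ apply continuity_2d_pt_id1 | apply continuity_2d_pt_id2
  | apply continuity_2d_pt_const
  | apply continuity_2d_pt_plus | apply continuity_2d_pt_minus
  | apply continuity_2d_pt_opp | apply continuity_2d_pt_mult
  | apply (continuity_1d_2d_pt_comp exp);
      [ apply derivable_continuous_pt, derivable_pt_exp | ]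
  | apply (continuity_1d_2d_pt_comp cos); [ apply continuity_cos | ]
  | apply (continuity_1d_2d_pt_comp sin); [ apply continuity_sin | ]
  | apply (continuity_1d_2d_pt_comp (fun y => y ^ 2));
      [ apply derivable_continuous_pt, derivable_pt_pow | ] ].

(** * Gaussian integral and Dawson's integral *)

(* The left-hand side has derivative 0 in t, and at t = 0 it is atan 1. *)
Lemma RInt_gauss_sq (al t : R) :
  al * (RInt (fun x => exp (- (al * x ^ 2))) 0 t) ^ 2 +
  RInt (fun x => exp (- (al * t ^ 2 * (1 + x ^ 2))) / (1 + x ^ 2)) 0 1 = PI / 4.
Proof.
set (g := fun x => exp (- (al * x ^ 2))).
set (h := fun u x => exp (- (al * u ^ 2 * (1 + x ^ 2))) / (1 + x ^ 2)).
set (dh := fun u x => - 2 * al * u * exp (- (al * u ^ 2 * (1 + x ^ 2)))).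
set (Phi := fun u => al * (RInt g 0 u) ^ 2 + RInt (h u) 0 1).
assert (Hg : forall x, ex_derive g x) by (intros x; unfold g; auto_derive; easy).
assert (Hdh : forall u, RInt (dh u) 0 1 = - 2 * al * g u * RInt g 0 u).
{ intros u.
  (* The substitution y = u * x carries [0, 1] to [0, u]. *)
  assert (E := RInt_comp_lin (V := R_CompleteNormedModule) g u 0 0 1).
  rewrite Rmult_0_r, Rmult_1_r, !Rplus_0_r in E; rewrite <- E by now apply RInt_ex_derive.
  rewrite <- (RInt_scal (V := R_CompleteNormedModule) _ 0 1 (- 2 * al * g u)).
  - apply RInt_ext; intros x _; unfold dh, g, scal; cbn -[pow]; unfold mult; cbn -[pow].
    rewrite Rplus_0_r.
    replace (- (al * u ^ 2 * (1 + x ^ 2))) with (- (al * u ^ 2) + - (al * (u * x) ^ 2)) by ring.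
    rewrite exp_plus; ring.
  - apply RInt_ex_derive; intros x; unfold g, scal; cbn -[pow]; unfold mult; cbn -[pow].
    auto_derive; easy. }
assert (HPhi : forall u, is_derive Phi u 0).
{ intros u; evar_last.
  - apply (is_derive_plus (V := R_NormedModule)).
    + apply (is_derive_scal (fun v => RInt g 0 v ^ 2)), is_derive_pow.
      now apply is_derive_RInt_upper.
    + apply is_derive_RInt_parameter with (df := dh).
      * intros v x; unfold h, dh; auto_derive; [ easy | simpl pow; field; nra ].
      * intros v x; unfold dh; cont2d.
      * intros v x; unfold h; auto_derive; nra.
  - rewrite Hdh; unfold plus; cbn; ring. }
change (Phi t = PI / 4); transitivity (Phi 0).
- destruct (MVT_gen Phi 0 t (fun _ => 0)) as [c [_ Hc]].
  + intros x _; apply HPhi.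
  + intros x _; apply derivable_continuous_pt; exists 0; apply is_derive_Reals, HPhi.
  + lra.
- unfold Phi.
  rewrite (RInt_point (V := R_CompleteNormedModule) 0 g : RInt g 0 0 = 0).
  rewrite (is_RInt_unique (h 0) 0 1 (PI / 4)); [ ring | ].
  evar_last.
  + apply (is_RInt_derive (V := R_CompleteNormedModule) atan (h 0)).
    * intros x _; evar_last; [ apply is_derive_atan | ].
      unfold h, Rsqr; replace (- (al * 0 ^ 2 * (1 + x ^ 2))) with 0 by ring.
      rewrite exp_0; field; nra.
    * intros x _; apply (ex_derive_continuous (V := R_NormedModule)).
      unfold h; auto_derive; nra.
  + rewrite atan_1, atan_0; apply Rminus_0_r.
Qed.

(** The second integral in [RInt_gauss_sq] is nonnegative, so al times the squared Gaussian integral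
    is at most PI / 4. *)
Lemma RInt_gauss_le (al t : R) :
  0 < al -> 0 <= t ->
  RInt (fun x => exp (- (al * x ^ 2))) 0 t <= sqrt (PI / al) / 2.
Proof.
intros Hal Ht.
assert (HS := RInt_gauss_sq al t).
assert (0 <= RInt (fun x => exp (- (al * t ^ 2 * (1 + x ^ 2))) / (1 + x ^ 2)) 0 1).
{ apply RInt_ge_0; [ lra | | ].
  - apply RInt_ex_derive; intros x; auto_derive; nra.
  - intros x _; assert (H := exp_pos (- (al * t ^ 2 * (1 + x ^ 2)))).
    apply Rlt_le, Rdiv_lt_0_compat; nra. }
set (I := RInt _ 0 t) in *.
apply Rle_trans with (Rabs I); [ apply Rle_abs | ].
rewrite <- sqrt_Rsqr_abs.
replace 2 with (sqrt (2 * 2)) by (apply sqrt_square; lra).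
rewrite <- sqrt_div by (try apply Rdiv_lt_0_compat; try apply Rlt_le, Rdiv_lt_0_compat; try apply PI_RGT_0; lra).
apply sqrt_le_1_alt, (Rmult_le_reg_l al); [ lra | ].
unfold Rsqr; field_simplify; lra.
Qed.

(** After the reflection u -> s - u of the Gaussian integral the integrands compare pointwise: u ^ 2
    - s ^ 2 + (s - u) ^ 2 = - 2 * u * (s - u) <= 0 on [0, s]. *)
Lemma dawson_le (al s : R) :
  0 < al -> 0 <= s ->
  exp (- (al * s ^ 2)) * RInt (fun u => exp (al * u ^ 2)) 0 s <=
  sqrt (PI / al) / 2.
Proof.
intros Hal Hs.
apply Rle_trans with (2 := RInt_gauss_le al s Hal Hs).
replace (RInt (fun x => exp (- (al * x ^ 2))) 0 s)
  with (RInt (fun u => exp (- (al * (s - u) ^ 2))) 0 s).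
2: { assert (H := RInt_comp_lin (V := R_CompleteNormedModule)
       (fun x => exp (- (al * x ^ 2))) (-1) s 0 s).
     replace (-1 * 0 + s) with s in H by ring.
     replace (-1 * s + s) with 0 in H by ring.
     rewrite <- (opp_RInt_swap (V := R_CompleteNormedModule) (fun x => exp (- (al * x ^ 2))) s 0), <- H;
       try (apply RInt_ex_derive; intros x; auto_derive; easy).
     rewrite <- (RInt_opp (V := R_CompleteNormedModule)).
     2: { apply RInt_ex_derive; intros x; unfold scal; cbn; unfold mult; cbn.
          auto_derive; easy. }
     apply RInt_ext; intros x _; unfold scal, opp; cbn; unfold mult; cbn.
     replace (-1 * x + s) with (s - x) by ring; ring. }
rewrite <- (RInt_scal (V := R_CompleteNormedModule)).
2: apply RInt_ex_derive; intros x; auto_derive; easy.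
apply RInt_le; [ lra | | | ];
  try (apply RInt_ex_derive; intros x; unfold scal; cbn; unfold mult; cbn;
       auto_derive; easy).
intros u Hu; unfold scal; cbn; unfold mult; cbn.
rewrite <- exp_plus; apply exp_le.
assert (0 <= al * (2 * u * (s - u))) by (apply Rmult_le_pos; nra).
nra.
Qed.

(** * Fourier integrals of a truncated Gaussian *)

(** Cauchy-Schwarz for two unit vectors, from the squared length of their difference. *)
Lemma unit_rot_le_1 (c d x : R) : c ^ 2 + d ^ 2 = 1 -> c * sin x + d * cos x <= 1.
Proof.
intros H; assert (E := sin2_cos2 x); unfold Rsqr in E.
assert (H1 := pow2_ge_0 (c - sin x)); assert (H2 := pow2_ge_0 (d - cos x)); lra.
Qed.

(* Differentiating [exp (- al * (x + I s) ^ 2)] in s amounts, up to the factor I,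
   to differentiating it in x, so that the integral has a boundary derivative. *)
Lemma is_derive_shifted_gauss (al a b c d s : R) :
  is_derive (fun v => RInt (fun x => exp (al * (v ^ 2 - x ^ 2)) *
      (c * cos (2 * al * v * x) - d * sin (2 * al * v * x))) a b) s
    (exp (al * (s ^ 2 - b ^ 2)) * (c * sin (2 * al * s * b) + d * cos (2 * al * s * b))
     - exp (al * (s ^ 2 - a ^ 2)) * (c * sin (2 * al * s * a) + d * cos (2 * al * s * a))).
Proof.
set (df := fun u x => exp (al * (u ^ 2 - x ^ 2)) *
  (2 * al * u * (c * cos (2 * al * u * x) - d * sin (2 * al * u * x))
   - 2 * al * x * (c * sin (2 * al * u * x) + d * cos (2 * al * u * x)))).
evar_last.
- apply is_derive_RInt_parameter with (df := df).
  + intros u x; unfold df; auto_derive; [ easy | unfold Rminus; simpl pow; ring ].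
  + intros u x; unfold df; cont2d.
  + intros u x; auto_derive; easy.
- apply is_RInt_unique.
  (* With c cos - d sin as the real part of a rotated exponential, the antiderivative of [df s] in x
     carries the imaginary part c sin + d cos. *)
  apply (is_RInt_derive (V := R_CompleteNormedModule) (fun x =>
    exp (al * (s ^ 2 - x ^ 2)) *
    (c * sin (2 * al * s * x) + d * cos (2 * al * s * x)))).
  + intros x _; unfold df; auto_derive; [ easy | unfold Rminus; simpl pow; ring ].
  + intros x _; apply (ex_derive_continuous (V := R_NormedModule)).
    unfold df; auto_derive; easy.
Qed.

(** With [C] the sum of the boundary weights, F - C * D is nonincreasing on [0, s], so F(s) <= F(0)
    + C * D(s). The factor 1 / 2 on the boundary terms is the one in [dawson_le]. *)
Lemma gauss_fourier_le_nonneg (al a b c d s : R) :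
  0 < al -> a <= 0 <= b -> c ^ 2 + d ^ 2 = 1 -> 0 <= s ->
  RInt (fun x => exp (- (al * x ^ 2)) *
     (c * cos (2 * al * s * x) - d * sin (2 * al * s * x))) a b <=
  sqrt (PI / al) *
  (exp (- (al * s ^ 2)) + (exp (- (al * a ^ 2)) + exp (- (al * b ^ 2))) / 2).
Proof.
intros Hal Hab Hcd Hs.
set (F := fun v => RInt (fun x => exp (al * (v ^ 2 - x ^ 2)) *
      (c * cos (2 * al * v * x) - d * sin (2 * al * v * x))) a b).
set (C := exp (- (al * a ^ 2)) + exp (- (al * b ^ 2))).
set (D := fun v => RInt (fun u => exp (al * u ^ 2)) 0 v).
assert (HK : F s - C * D s <= F 0 - C * D 0).
{ apply (nonpos_derive_le (fun v => F v - C * D v) (fun v =>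
    (exp (al * (v ^ 2 - b ^ 2)) * (c * sin (2 * al * v * b) + d * cos (2 * al * v * b))
     - exp (al * (v ^ 2 - a ^ 2)) * (c * sin (2 * al * v * a) + d * cos (2 * al * v * a)))
    - C * exp (al * v ^ 2))); [ easy | | ].
  - intros v _.
    apply (is_derive_minus (V := R_NormedModule)).
    + apply is_derive_shifted_gauss.
    + apply (is_derive_scal D), (is_derive_RInt_upper (fun u => exp (al * u ^ 2))).
      intros x; auto_derive; easy.
  - intros v _; unfold C.
    replace (al * (v ^ 2 - b ^ 2)) with (- (al * b ^ 2) + al * v ^ 2) by ring.
    replace (al * (v ^ 2 - a ^ 2)) with (- (al * a ^ 2) + al * v ^ 2) by ring.
    rewrite !exp_plus.
    assert (Hb := unit_rot_le_1 c d (2 * al * v * b) Hcd).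
    (* The boundary term at [a] enters with a minus sign, hence the opposite unit vector. *)
    assert (Ha := unit_rot_le_1 (- c) (- d) (2 * al * v * a)).
    assert (P1 := exp_pos (- (al * a ^ 2))).
    assert (P2 := exp_pos (- (al * b ^ 2))).
    assert (P3 := exp_pos (al * v ^ 2)).
    assert (Q1 := Rmult_lt_0_compat _ _ P1 P3).
    assert (Q2 := Rmult_lt_0_compat _ _ P2 P3).
    nra. }
replace (D 0) with 0 in HK
  by (symmetry; apply (RInt_point (V := R_CompleteNormedModule))).
(* At v = 0 the integrand is c times the Gaussian, with c <= 1. Splitting at 0 and reflecting the
   left part gives two integrals, each at most sqrt (PI / al) / 2. *)
assert (HF0 : F 0 <= sqrt (PI / al)).
{ unfold F; set (g := fun x => exp (- (al * x ^ 2))).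
  assert (Hg : forall x, ex_derive g x) by (intros x; unfold g; auto_derive; easy).
  apply Rle_trans with (RInt g a b).
  { apply RInt_le; [ lra | | now apply RInt_ex_derive | ].
    - apply RInt_ex_derive; intros x; auto_derive; easy.
    - intros x _; unfold g.
      replace (2 * al * 0 * x) with 0 by ring; rewrite cos_0, sin_0.
      replace (al * (0 ^ 2 - x ^ 2)) with (- (al * x ^ 2)) by ring.
      assert (P := exp_pos (- (al * x ^ 2))).
      assert (c <= 1) by nra.
      nra. }
  rewrite <- (RInt_Chasles (V := R_CompleteNormedModule) g a 0 b)
    by now apply RInt_ex_derive.
  assert (H1 := RInt_gauss_le al b Hal (proj2 Hab)); fold g in H1.
  assert (H2 := RInt_gauss_le al (- a) Hal ltac:(lra)); fold g in H2.
  replace (RInt g a 0) with (RInt g 0 (- a)); [ change (RInt g 0 (- a) + RInt g 0 b <= sqrt (PI / al)); lra | ].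
  assert (H := RInt_comp_lin (V := R_CompleteNormedModule) g (-1) 0 0 a).
  replace (-1 * 0 + 0) with 0 in H by ring.
  replace (-1 * a + 0) with (- a) in H by ring.
  rewrite <- H by now apply RInt_ex_derive.
  rewrite <- (opp_RInt_swap (V := R_CompleteNormedModule) g 0 a)
    by now apply RInt_ex_derive.
  rewrite <- (RInt_opp (V := R_CompleteNormedModule)) by now apply RInt_ex_derive.
  apply RInt_ext; intros x _; unfold g, scal, opp; cbn; unfold mult; cbn.
  replace ((-1 * x + 0) * ((-1 * x + 0) * 1)) with (x * (x * 1)) by ring; ring. }
replace (RInt _ a b) with (exp (- (al * s ^ 2)) * F s).
2: { unfold F; rewrite <- (RInt_scal (V := R_CompleteNormedModule)).
     2: apply RInt_ex_derive; intros x; auto_derive; easy.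
     apply RInt_ext; intros x _; unfold scal; cbn -[pow]; unfold mult; cbn -[pow].
     rewrite <- Rmult_assoc, <- exp_plus; do 2 f_equal; ring. }
assert (HD := dawson_le al s Hal Hs); fold (D s) in HD.
assert (P := exp_pos (- (al * s ^ 2))).
assert (PC : 0 < C) by (unfold C; apply Rplus_lt_0_compat; apply exp_pos).
apply Rle_trans with (exp (- (al * s ^ 2)) * (sqrt (PI / al) + C * D s)).
- apply Rmult_le_compat_l; lra.
- assert (H := Rmult_le_compat_l C _ _ (Rlt_le _ _ PC) HD); lra.
Qed.

(** Changing the signs of both s and d leaves the integrand unchanged. *)
Lemma gauss_fourier_le (al a b c d s : R) :
  0 < al -> a <= 0 <= b -> c ^ 2 + d ^ 2 = 1 ->
  RInt (fun x => exp (- (al * x ^ 2)) *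
     (c * cos (2 * al * s * x) - d * sin (2 * al * s * x))) a b <=
  sqrt (PI / al) *
  (exp (- (al * s ^ 2)) + (exp (- (al * a ^ 2)) + exp (- (al * b ^ 2))) / 2).
Proof.
intros Hal Hab Hcd.
destruct (Rle_or_lt 0 s) as [Hs | Hs].
- now apply gauss_fourier_le_nonneg.
- replace (s ^ 2) with ((- s) ^ 2) by ring.
  rewrite (RInt_ext _ (fun x => exp (- (al * x ^ 2)) *
     (c * cos (2 * al * - s * x) - (- d) * sin (2 * al * - s * x)))).
  + apply gauss_fourier_le_nonneg; try easy; [ | lra ].
    rewrite <- Hcd; ring.
  + intros x _.
    replace (2 * al * - s * x) with (- (2 * al * s * x)) by ring.
    rewrite cos_neg, sin_neg; apply Rminus_diag_uniq; ring.
Qed.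

(** Translating by x0 produces the phase exp (I k x0), which rotates (c, d) into the unit vector
    (c', d'). The translated interval contains 0 because |x0| <= lam, and its endpoints lie at
    distance at least lam - |x0| from 0. *)
Lemma shifted_gauss_fourier_le (al x0 lam c d k : R) :
  0 < al -> Rabs x0 <= lam -> c ^ 2 + d ^ 2 = 1 ->
  RInt (fun x => exp (- al * (x - x0) ^ 2) * (c * cos (k * x) - d * sin (k * x)))
    (- lam) lam <=
  sqrt (PI / al) * (exp (- (k ^ 2 / (4 * al))) + exp (- al * (lam - Rabs x0) ^ 2)).
Proof.
intros Hal Hx0 Hcd.
set (c' := c * cos (k * x0) - d * sin (k * x0)).
set (d' := c * sin (k * x0) + d * cos (k * x0)).
assert (Hcd' : c' ^ 2 + d' ^ 2 = 1).
{ assert (E := sin2_cos2 (k * x0)); unfold Rsqr in E; rewrite <- Hcd; unfold c', d'.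
  transitivity ((c ^ 2 + d ^ 2) *
    (sin (k * x0) * sin (k * x0) + cos (k * x0) * cos (k * x0))); [ ring | ].
  rewrite E; ring. }
assert (Hx := Rabs_le_between x0 lam); apply Hx in Hx0 as Hx0'.
assert (H := gauss_fourier_le al (- lam - x0) (lam - x0) c' d' (k / (2 * al))
  Hal ltac:(lra) Hcd').
replace (al * (k / (2 * al)) ^ 2) with (k ^ 2 / (4 * al)) in H by (field; lra).
replace (RInt _ (- lam) lam) with (RInt (fun x => exp (- (al * x ^ 2)) *
  (c' * cos (2 * al * (k / (2 * al)) * x) - d' * sin (2 * al * (k / (2 * al)) * x)))
  (- lam - x0) (lam - x0)).
- apply Rle_trans with (1 := H), Rmult_le_compat_l; [ apply sqrt_pos | ].
  (* The larger of (lam - x0) ^ 2 and (lam + x0) ^ 2 exceeds (lam - |x0|) ^ 2 by 4 * lam * |x0|; the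
     smaller equals it. *)
  assert (0 <= al * (lam * Rabs x0)).
  { assert (P := Rabs_pos x0); repeat apply Rmult_le_pos; lra. }
  assert (exp (- (al * (- lam - x0) ^ 2)) <= exp (- al * (lam - Rabs x0) ^ 2)).
  { apply exp_le; unfold Rabs in *; destruct (Rcase_abs x0); lra. }
  assert (exp (- (al * (lam - x0) ^ 2)) <= exp (- al * (lam - Rabs x0) ^ 2)).
  { apply exp_le; unfold Rabs in *; destruct (Rcase_abs x0); lra. }
  lra.
- assert (E := RInt_comp_lin (V := R_CompleteNormedModule) (fun x => exp (- (al * x ^ 2)) *
  (c' * cos (2 * al * (k / (2 * al)) * x) - d' * sin (2 * al * (k / (2 * al)) * x)))
    1 (- x0) (- lam) lam).
  replace (1 * - lam + - x0) with (- lam - x0) in E by ring.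
  replace (1 * lam + - x0) with (lam - x0) in E by ring.
  rewrite <- E by (apply RInt_ex_derive; intros x; auto_derive; easy).
  apply RInt_ext; intros x _; unfold scal; cbn -[pow]; unfold mult; cbn -[pow].
  replace (1 * x + - x0) with (x - x0) by ring.
  rewrite Rmult_1_l; f_equal; [ f_equal; ring | ].
  replace (k * x) with (k * (x - x0) + k * x0) by ring.
  replace (2 * al * (k / (2 * al)) * (x - x0)) with (k * (x - x0)) by (field; lra).
  rewrite cos_plus, sin_plus; unfold c', d'; ring.
Qed.

(** * From real bounds to the modulus of the coefficient *)

(** For z <> 0 the unit vector z / |z| attains the modulus; for z = 0 any direction shows 0 <= M. *)
Lemma Cmod_le_support (z : C) (M : R) :
  (forall c d, c ^ 2 + d ^ 2 = 1 -> c * fst z + d * snd z <= M) -> Cmod z <= M.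
Proof.
intros H.
destruct (Req_dec (Cmod z) 0) as [E | E].
- assert (H1 := H 1 0 ltac:(ring)).
  rewrite E; apply Cmod_eq_0 in E; rewrite E in H1; cbn in H1; lra.
- assert (E2 : Cmod z ^ 2 = fst z ^ 2 + snd z ^ 2).
  { unfold Cmod; rewrite pow2_sqrt; nra. }
  apply Rle_trans with (fst z / Cmod z * fst z + snd z / Cmod z * snd z).
  + apply Req_le, (Rmult_eq_reg_r (Cmod z)); [ | easy ].
    field_simplify; lra.
  + apply H, (Rmult_eq_reg_r (Cmod z ^ 2)); [ | now apply pow_nonzero ].
    field_simplify; lra.
Qed.

(** Integrates real and imaginary parts separately; it also shows that the integral in
    [stretched_coef] exists here. *)
Lemma is_RInt_gauss_cos_coef (alpha x0 omega lam : R) (n : Z) :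
  lam <> 0 ->
  is_RInt (V := C_R_NormedModule)
    (fun x : R => RtoC (gauss_cos alpha x0 omega x) *
       Cexp (- (PI * Ci * IZR n * x / lam)))%C (- lam) lam
    (RInt (fun x => gauss_cos alpha x0 omega x * cos (PI * IZR n / lam * x)) (- lam) lam,
     RInt (fun x => - (gauss_cos alpha x0 omega x * sin (PI * IZR n / lam * x))) (- lam) lam).
Proof.
intros Hlam.
apply (is_RInt_ext (V := C_R_NormedModule) (fun x =>
  (gauss_cos alpha x0 omega x * cos (PI * IZR n / lam * x),
   - (gauss_cos alpha x0 omega x * sin (PI * IZR n / lam * x))))).
- intros x _.
  replace (- (PI * Ci * IZR n * x / lam))%C with (0, - (PI * IZR n / lam * x)).
  + unfold Cexp; cbn [Re Im fst snd].
    rewrite exp_0, cos_neg, sin_neg.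
    unfold Cmult, Cplus, RtoC, Ci; cbn; f_equal; ring.
  + unfold Cdiv, Cinv, Cmult, Copp, RtoC, Ci; cbn; f_equal; field; easy.
- apply (is_RInt_fct_extend_pair (U := R_NormedModule) (V := R_NormedModule));
    cbn [fst snd]; apply (RInt_correct (V := R_CompleteNormedModule)), RInt_ex_derive;
    intros x; unfold gauss_cos; auto_derive; easy.
Qed.

(** Serves to replace both frequencies p - omega and p + omega by |p| - |omega|; the reverse
    triangle inequality supplies the hypothesis. *)
Lemma gauss_decay_le (al p q w : R) :
  0 < al -> (p - q) ^ 2 <= w ^ 2 ->
  exp (- (w ^ 2 / (4 * al))) <= exp (- ((p - q) ^ 2 / (4 * al))).
Proof.
intros Hal H; apply exp_le, Ropp_le_contravar.
apply Rmult_le_compat_r; [ apply Rlt_le, Rinv_0_lt_compat; lra | easy ].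
Qed.

(* [Rabs omega] in the bound: the coefficient is even in omega, and for
   omega < 0 the bound with omega in place of [Rabs omega] fails in general. *)
Theorem theorem2p1 (alpha x0 omega lam : R)
  (Halpha : 0 < alpha) (Hlam : 0 < lam) (Hx0 : Rabs x0 <= lam) (n : Z) :
  Cmod (stretched_coef lam (fun x => RtoC (gauss_cos alpha x0 omega x)) n) <=
  sqrt (PI / (2 * alpha * lam)) *
  (exp (- ((PI * Rabs (IZR n) - lam * Rabs omega) ^ 2 / (4 * alpha * lam ^ 2)))
   + exp (- alpha * (lam - Rabs x0) ^ 2)).
Proof.
unfold stretched_coef; rewrite Cmod_mult, Cmod_R, Rabs_pos_eq.
2: apply Rlt_le, Rinv_0_lt_compat, sqrt_lt_R0; lra.
assert (HPI := PI_RGT_0).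
(* The normalisation 1 / sqrt (2 * lam) is split off on both sides, leaving the constant sqrt (PI /
   alpha). *)
replace (PI / (2 * alpha * lam)) with (PI / alpha / (2 * lam)) by (field; lra).
rewrite sqrt_div_alt by lra.
unfold Rdiv at 1; rewrite (Rmult_comm _ (/ sqrt (2 * lam))), Rmult_assoc.
apply Rmult_le_compat_l.
{ apply Rlt_le, Rinv_0_lt_compat, sqrt_lt_R0; lra. }
rewrite (is_RInt_unique (V := C_R_CompleteNormedModule) _ _ _ _
  (is_RInt_gauss_cos_coef alpha x0 omega lam n ltac:(lra))).
set (p := PI * IZR n / lam).
replace ((PI * Rabs (IZR n) - lam * Rabs omega) ^ 2 / (4 * alpha * lam ^ 2))
  with ((Rabs p - Rabs omega) ^ 2 / (4 * alpha)).
2: { unfold p, Rdiv; rewrite !Rabs_mult, Rabs_inv, (Rabs_pos_eq PI), (Rabs_pos_eq lam) by lra.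
     field; lra. }
apply Cmod_le_support; intros c d Hcd; cbn [fst snd].
set (G := fun k x => exp (- alpha * (x - x0) ^ 2) * (c * cos (k * x) - d * sin (k * x))).
assert (HG : forall k, ex_RInt (G k) (- lam) lam).
{ intros k; apply RInt_ex_derive; intros x; unfold G; auto_derive; easy. }
(* Product-to-sum: each of the frequencies p - omega and p + omega has weight 1 / 2, so their two
   bounds are averaged and no factor 2 arises. *)
assert (E : c * RInt (fun x => gauss_cos alpha x0 omega x * cos (p * x)) (- lam) lam +
  d * RInt (fun x => - (gauss_cos alpha x0 omega x * sin (p * x))) (- lam) lam =
  / 2 * (RInt (G (p - omega)) (- lam) lam + RInt (G (p + omega)) (- lam) lam)).
{ rewrite <- (RInt_plus (V := R_CompleteNormedModule)) by apply HG.
  assert (Hr : forall f : R -> R, (forall x, ex_derive f x) -> forall r,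
    r * RInt f (- lam) lam = RInt (fun x => r * f x) (- lam) lam).
  { intros f Hf r; symmetry.
    apply (RInt_scal (V := R_CompleteNormedModule)), RInt_ex_derive, Hf. }
  rewrite !Hr; try (intros x; unfold G, gauss_cos, plus; cbn -[pow]; auto_derive; easy).
  rewrite <- (RInt_plus (V := R_CompleteNormedModule));
    try (apply RInt_ex_derive; intros x; unfold gauss_cos; auto_derive; easy).
  apply RInt_ext; intros x _; unfold G, gauss_cos, plus; cbn -[pow].
  replace ((p - omega) * x) with (p * x - omega * x) by ring.
  replace ((p + omega) * x) with (p * x + omega * x) by ring.
  rewrite cos_minus, sin_minus, cos_plus, sin_plus; field. }
rewrite E.
assert (H1 := shifted_gauss_fourier_le alpha x0 lam c d (p - omega) Halpha Hx0 Hcd).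
assert (H2 := shifted_gauss_fourier_le alpha x0 lam c d (p + omega) Halpha Hx0 Hcd).
fold (G (p - omega)) in H1; fold (G (p + omega)) in H2.
assert (D1 := gauss_decay_le alpha (Rabs p) (Rabs omega) (p - omega) Halpha).
assert (D2 := gauss_decay_le alpha (Rabs p) (Rabs omega) (p + omega) Halpha).
lapply D1; [ clear D1; intros D1 |
  unfold Rabs; destruct (Rcase_abs p), (Rcase_abs omega); nra ].
lapply D2; [ clear D2; intros D2 |
  unfold Rabs; destruct (Rcase_abs p), (Rcase_abs omega); nra ].
assert (Q := sqrt_pos (PI / alpha)).
assert (M1 := Rmult_le_compat_l _ _ _ Q D1).
assert (M2 := Rmult_le_compat_l _ _ _ Q D2).
lra.
Qed.
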